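(* For any $n \in \mathbb{Z}$, the following are equivalent: (1) The image of $\left(n^{\frac{k_p+1}{2}}\right)_{p \in \mathbb{P}} \in \mathbb{Z}^{\mathbb{P}}$ in $\mathscr{A}$ is transcendental over $\mathbb{Q}$. (2) The inequality $|n| > 1$ holds.
   Context: $\mathbb{P}$ denotes the set of prime numbers; $\mathbb{F}_p = \mathbb{Z}/p\mathbb{Z}$. For $p \in \mathbb{P}$, $k_p$ denotes the greatest odd divisor of $p-1$. The ring $\mathscr{A}$ of integers modulo infinitely large primes is $\mathscr{A} = \prod_{p \in \mathbb{P}} \mathbb{F}_p \big/ \bigoplus_{p \in \mathbb{P}} \mathbb{F}_p$, a commutative $\mathbb{Q}$-algebra (each nonzero integer is invertible modulo all but finitely many primes). The image in $\mathscr{A}$ of a sequence of integers $(a(p))_{p \in \mathbb{P}}$ is the class of $(a(p) \bmod p)_{p \in \mathbb{P}}$. An element $\alpha \in \mathscr{A}$ is (naively) algebraic over $\mathbb{Q}$ if there is a nonzero $g \in \mathbb{Q}[x]$ with $g(\alpha) = 0$ in $\mathscr{A}$, and (naively) transcendental over $\mathbb{Q}$ otherwise. *)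

(* Defs.v *)
From HB Require Import structures.
From mathcomp Require Import all_boot all_order all_algebra.
From mathcomp Require Import ring.
From mathcomp Require Import boolp classical_sets cardinality.

Set Implicit Arguments.
Unset Strict Implicit.
Unset Printing Implicit Defensive.

Import GRing.Theory.
Local Open Scope ring_scope.
Local Open Scope quotient_scope.

Definition Primes := {p : nat | prime p}.

Definition prodF := forall p : Primes, 'F_(val p).

HB.instance Definition _ := gen_eqMixin prodF.
HB.instance Definition _ := gen_choiceMixin prodF.

Section ProductRing.

Implicit Types f g h : prodF.

Definition prodF_zero : prodF := fun=> 0.
Definition prodF_opp f : prodF := fun p => - f p.
Definition prodF_add f g : prodF := fun p => f p + g p.
Definition prodF_one : prodF := fun=> 1.
Definition prodF_mul f g : prodF := fun p => f p * g p.

Fact prodF_addA : associative prodF_add.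
Proof. by move=> f g h; apply: functional_extensionality_dep => p; apply: addrA. Qed.

Fact prodF_addC : commutative prodF_add.
Proof. by move=> f g; apply: functional_extensionality_dep => p; apply: addrC. Qed.

Fact prodF_add0 : left_id prodF_zero prodF_add.
Proof. by move=> f; apply: functional_extensionality_dep => p; apply: add0r. Qed.

Fact prodF_addN : left_inverse prodF_zero prodF_opp prodF_add.
Proof. by move=> f; apply: functional_extensionality_dep => p; apply: addNr. Qed.

HB.instance Definition _ := GRing.isZmodule.Build prodF
  prodF_addA prodF_addC prodF_add0 prodF_addN.

Fact prodF_mulA : associative prodF_mul.
Proof. by move=> f g h; apply: functional_extensionality_dep => p; apply: mulrA. Qed.

Fact prodF_mulC : commutative prodF_mul.
Proof. by move=> f g; apply: functional_extensionality_dep => p; apply: mulrC. Qed.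

Fact prodF_mul1 : left_id prodF_one prodF_mul.
Proof. by move=> f; apply: functional_extensionality_dep => p; apply: mul1r. Qed.

Fact prodF_mulD : left_distributive prodF_mul (@GRing.add prodF).
Proof. by move=> f g h; apply: functional_extensionality_dep => p; apply: mulrDl. Qed.

Fact prodF_1neq0 : prodF_one != 0.
Proof.
apply/eqP => /(congr1 (fun f : prodF => f (exist prime 2%N isT))).
by apply/eqP; apply: oner_neq0.
Qed.

HB.instance Definition _ := GRing.Zmodule_isComNzRing.Build prodF
  prodF_mulA prodF_mulC prodF_mul1 prodF_mulD prodF_1neq0.

End ProductRing.

Definition sumF : {pred prodF} :=
  fun f => `[< finite_set [set p | f p != 0]%classic >].

Fact Primes_infinite : ~ finite_set [set: Primes]%classic.
Proof.
move=> /finite_seqP[s sE].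
have [p lt_sp p_pr] := prime_above (\max_(q <- s) val q).
have p_s : (exist prime p p_pr : Primes) \in s.
  have: [set: Primes]%classic (exist prime p p_pr) by [].
  by rewrite sE.
have := @leq_bigmax_seq _ s xpredT (fun q : Primes => val q) _ p_s isT.
by rewrite leqNgt lt_sp.
Qed.

Fact sumF_idealr : idealr_closed sumF.
Proof.
split.
- apply/asboolP; apply: (sub_finite_set _ (finite_set0 Primes)) => p /=.
  by case/eqP.
- apply/negP => /asboolP fin1; apply: Primes_infinite.
  by apply: sub_finite_set fin1 => p _; exact: (oner_neq0 'F_(val p)).
- move=> a f g /asboolP finf /asboolP fing; apply/asboolP.
  have: finite_set ([set p | f p != 0] `|` [set p | g p != 0])%classic.
    by rewrite finite_setU.
  apply: sub_finite_set => p /= afg_neq0.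
  have [f0|] := eqVneq (f p) 0; last by left.
  right; apply: contra_neq afg_neq0 => g0.
  change (a p * f p + g p = 0); by rewrite f0 g0 mulr0 addr0.
Qed.

HB.instance Definition _ := isIdealr.Build prodF sumF sumF_idealr.

Definition scrA := {ideal_quot sumF}.

HB.instance Definition _ := GRing.ComNzRing.on scrA.
HB.instance Definition _ := Quotient.on scrA.

Definition classA (f : prodF) : scrA := \pi_scrA f.

Fact classA_eqP (f g : prodF) :
  finite_set [set p | f p != g p]%classic -> classA f = classA g.
Proof.
move=> fin; apply/eqP; rewrite /classA -[_ == _]/(_ == _ %[mod {ideal_quot sumF}]).
rewrite eqmodE; apply/asboolP; apply: sub_finite_set fin => p /=.
by apply: contra_neq => fg; change (f p - g p = 0); rewrite fg subrr.
Qed.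

(* At the finitely many p dividing denq q, the p-th component ratr q is a junk
   value (0^-1 = 0), which the quotient does not see. *)
Definition ratA (q : rat) : scrA := classA (fun p => ratr q).

Fact ratr_frac (F : fieldType) (q : rat) (n d : int) :
  d%:~R != 0 :> F -> q * d%:~R = n%:~R -> ratr q = n%:~R / d%:~R :> F.
Proof.
move=> d_neq0 qdE; have num_den : numq q * d = n * denq q.
  apply: (intr_inj (R := rat)); rewrite !rmorphM /= -qdE mulrAC.
  by rewrite numqE mulrAC.
have den_dvd : (denq q %| d)%Z.
  have: (denq q %| numq q * d)%Z by rewrite num_den dvdz_mull.
  by rewrite Gauss_dvdzr // coprimez_sym coprimezE coprime_num_den.
have b_neq0 : (denq q)%:~R != 0 :> F.
  move/dvdzP: den_dvd d_neq0 => [e ->]; rewrite rmorphM /= mulf_eq0 negb_or.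
  by case/andP.
by apply/eqP; rewrite /ratr eqr_div // -!rmorphM /= num_den.
Qed.

Fact finite_dvd (d : int) : d != 0 ->
  finite_set [set p : Primes | d%:~R == 0 :> 'F_(val p)]%classic.
Proof.
move=> d_neq0; apply: (@sub_finite_set _ _
  [set` pmap insub (iota 0 `|d|%N.+1) : seq Primes]%classic); last first.
  exact: finite_seq.
move=> p dp0; rewrite mksetE mem_pmap_sub mem_iota /= add0n ltnS.
apply: dvdn_leq; first by rewrite absz_gt0.
rewrite (dvdn_pcharf (pchar_Fp (valP p))).
by move: dp0; rewrite mksetE; case: (d) => m; rewrite ?NegzE ?rmorphN ?oppr_eq0 ?abszN.
Qed.

(* Almost all components see no denominator of q or r, so that q and r may be
   computed with as fractions there; this carries identities of rat to scrA. *)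
Fact classA_rat (q r : rat) (f g : prodF) :
    (forall p, (denq q)%:~R != 0 :> 'F_(val p) ->
               (denq r)%:~R != 0 :> 'F_(val p) -> f p = g p) ->
  classA f = classA g.
Proof.
move=> fg; apply: classA_eqP.
have: finite_set ([set p : Primes | ((denq q)%:~R : 'F_(val p)) == 0]
              `|` [set p : Primes | ((denq r)%:~R : 'F_(val p)) == 0])%classic.
  by rewrite finite_setU; split; apply: finite_dvd; apply: denq_neq0.
apply: sub_finite_set => p /= fgp.
have [q0|q0] := eqVneq ((denq q)%:~R : 'F_(val p)) 0; first by left.
by right; apply: contraTT fgp => r0; rewrite negbK fg.
Qed.

Fact ratA_add : {morph ratA : q r / q + r}.
Proof.
move=> q r; rewrite /ratA /classA -rmorphD; apply: (@classA_rat q r) => p q0 r0.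
rewrite (@ratr_frac _ (q + r) (numq q * denq r + numq r * denq q) (denq q * denq r)).
- rewrite -[RHS]/(ratr q + ratr r : 'F_(val p)) /ratr.
  by rewrite addf_div // !rmorphD !rmorphM.
- by rewrite rmorphM mulf_neq0.
- by rewrite !rmorphD !rmorphM /= !numqE; ring.
Qed.

Fact ratA_mul : {morph ratA : q r / q * r}.
Proof.
move=> q r; rewrite /ratA /classA -rmorphM; apply: (@classA_rat q r) => p q0 r0.
rewrite (@ratr_frac _ (q * r) (numq q * numq r) (denq q * denq r)).
- rewrite -[RHS]/(ratr q * ratr r : 'F_(val p)) /ratr.
  by rewrite mulf_div !rmorphM.
- by rewrite rmorphM mulf_neq0.
- by rewrite !rmorphM /= !numqE; ring.
Qed.

Fact ratA_1 : ratA 1 = 1.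
Proof.
rewrite /ratA -(rmorph1 (\pi_scrA : prodF -> scrA)); apply: classA_eqP.
apply: (sub_finite_set _ (finite_set0 Primes)) => p; rewrite mksetE.
by case/eqP; apply: (ratr_nat _ 1).
Qed.

Definition scaleA (q : rat) (x : scrA) : scrA := ratA q * x.

Fact scaleA_A q r x : scaleA q (scaleA r x) = scaleA (q * r) x.
Proof. by rewrite /scaleA ratA_mul mulrA. Qed.

Fact scaleA_1 : left_id 1 scaleA.
Proof. by move=> x; rewrite /scaleA ratA_1 mul1r. Qed.

Fact scaleA_Dr : right_distributive scaleA +%R.
Proof. by move=> q x y; rewrite /scaleA mulrDr. Qed.

Fact scaleA_Dl x : {morph scaleA^~ x : q r / q + r}.
Proof. by move=> q r; rewrite /scaleA ratA_add mulrDl. Qed.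

HB.instance Definition _ := GRing.Zmodule_isLmodule.Build rat scrA
  scaleA_A scaleA_1 scaleA_Dr scaleA_Dl.

Fact scaleA_Al (q : rat) (x y : scrA) : q *: (x * y) = q *: x * y.
Proof. exact: mulrA. Qed.

HB.instance Definition _ := GRing.Lmodule_isLalgebra.Build rat scrA scaleA_Al.
HB.instance Definition _ := GRing.Lalgebra_isComAlgebra.Build rat scrA.

Definition imageA (a : Primes -> int) : scrA := classA (fun p => (a p)%:~R).

Definition naively_algebraic (A : comAlgType rat) (x : A) : Prop :=
  exists2 g : {poly rat}, g != 0 & horner_alg x g = 0.

Definition naively_transcendental (A : comAlgType rat) (x : A) : Prop :=
  ~ naively_algebraic x.

Definition greatest_odd_divisor (m : nat) : nat :=
  \max_(d <- divisors m | odd d) d.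

Definition k_ (p : Primes) : nat := greatest_odd_divisor (val p).-1.

(* Main.v *)
(* Write c = n^(2^i). If p divides c^q + 1 with q odd, then -c has odd order
   modulo p, hence (-c)^(k_p) = 1, and the p-th component x of the image
   satisfies x^(2^(i+1)) = c * c^(k_p) = -c, i.e. it is a root of
   f_i = X^(2^(i+1)) + n^(2^i). Every prime factor p of (c^q + 1)/(c + 1), with
   q an odd prime, satisfies p >= q, so for each i this happens for infinitely
   many p. The f_i are pairwise coprime, so a given g <> 0 is coprime to some
   f_i; a Bezout relation then shows that f_i(x) is invertible in scrA if
   g(x) = 0, which contradicts the vanishing of infinitely many components. *)
Require Import Defs.
From mathcomp Require Import all_boot all_order all_algebra all_field.
From mathcomp Require Import boolp classical_sets cardinality zify.

Import Order.TTheory GRing.Theory Num.Theory.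

Set Implicit Arguments.
Unset Strict Implicit.
Unset Printing Implicit Defensive.

Local Open Scope ring_scope.

(** * Odd part of p - 1 and odd orders modulo p *)

Lemma greatest_odd_divisorE (m : nat) :
  (0 < m)%N -> greatest_odd_divisor m = (m`_(2^'))%N.
Proof.
move=> m_gt0; apply/eqP; rewrite eqn_leq; apply/andP; split.
  apply/bigmax_leqP_seq => d; rewrite -dvdn_divisors // => dm d_odd.
  apply: dvdn_leq; first exact: part_gt0.
  move: dm; rewrite -{1}(partnC 2%N m_gt0) Gauss_dvdr // coprime_sym.
  by rewrite p_part coprimeXl ?coprime2n.
apply: (@leq_bigmax_seq _ (divisors m) odd id).
  by rewrite -dvdn_divisors // dvdn_part.
by rewrite odd_2'nat part_pnat.
Qed.

Lemma k_odd (p : Primes) : odd (k_ p).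
Proof.
rewrite /k_ greatest_odd_divisorE ?odd_2'nat ?part_pnat //.
by have := prime_gt1 (valP p); case: (val p) => [|[]].
Qed.

Lemma odd_dvd_k (p : Primes) (d : nat) :
  odd d -> (d %| (val p).-1)%N -> (d %| k_ p)%N.
Proof.
have p1_gt0 : (0 < (val p).-1)%N.
  by have := prime_gt1 (valP p); case: (val p) => [|[]].
move=> d_odd; rewrite /k_ greatest_odd_divisorE // -{1}(partnC 2%N p1_gt0).
by rewrite Gauss_dvdr // coprime_sym p_part coprimeXl ?coprime2n.
Qed.

Lemma Fp_fermat (p : nat) (x : 'F_p) : prime p -> x != 0 -> x ^+ p.-1 = 1.
Proof.
move=> p_pr x0; apply: (mulfI x0).
have := expf_card x; rewrite card_Fp // => xp.
by rewrite -exprS prednK ?prime_gt0 // xp mulr1.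
Qed.

Lemma Fp_dvd_eq0 (p : nat) (z : int) :
  prime p -> (p %| `|z|)%N -> z%:~R = 0 :> 'F_p.
Proof.
move=> p_pr; rewrite (dvdn_pcharf (pchar_Fp p_pr)) => /eqP.
case: z => m // m0; rewrite NegzE abszN in m0 *.
by rewrite rmorphN /= [_%:~R]m0 oppr0.
Qed.

(** The order of x is odd as a divisor of q, and divides p - 1 by Fermat, so it divides k_p. *)
Lemma exp_k_odd_order (p : Primes) (x : 'F_(val p)) (q : nat) :
  odd q -> x ^+ q = 1 -> x ^+ k_ p = 1.
Proof.
move=> q_odd xq1; have q_gt0 : (0 < q)%N by case: q q_odd {xq1}.
have x0 : x != 0.
  apply/eqP => x0; move/eqP: xq1.
  by rewrite x0 expr0n gtn_eqF //= eq_sym oner_eq0.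
have [d dx dq] := prim_order_exists q_gt0 xq1.
apply/eqP; rewrite -(prim_order_dvd dx); apply: odd_dvd_k.
  exact: dvdn_odd dq q_odd.
by rewrite (prim_order_dvd dx) (Fp_fermat (valP p)).
Qed.

(** * Large primes modulo which b has odd order *)

(** If the sum were at most 1 in absolute value, then |b^q - 1| <= |b - 1|, against |b^q| >= |b|^3
    >= 4|b|. Hence the sum has a prime factor. *)
Lemma geometric_sum_gt1 (b : int) (q : nat) :
  (1 < `|b|)%N -> (2 < q)%N -> (1 < `|(\sum_(i < q) b ^+ i)%R|)%N.
Proof.
move=> b_gt1 q_gt2; set s := \sum_(i < q) _.
have sE : b ^+ q - 1 = (b - 1) * s by apply: subrX1.
have bq : (4 * `|b| <= `|(b ^+ q)%R|)%N.
  rewrite abszX; apply: (@leq_trans (`|b| ^ 3)%N); last first.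
    by rewrite leq_pexp2l; lia.
  by rewrite expnSr leq_mul2r (@leq_exp2r 2 _ 2) // b_gt1 orbT.
rewrite ltnNge; apply/negP => s_le1.
have : (`|(b ^+ q - 1)%R| <= `|(b - 1)%R|)%N.
  by rewrite sE abszM -[leqRHS]muln1 leq_mul2l s_le1 orbT.
by lia.
Qed.

(** The order of b modulo p divides the prime q. If it is 1, the sum is q modulo p, so p = q; if it
    is q, then q divides p - 1. *)
Lemma prime_factor_geometric_sum_ge (b : int) (p q : nat) :
  prime p -> prime q -> (p %| `|(\sum_(i < q) b ^+ i)%R|)%N -> (q <= p)%N.
Proof.
move=> p_pr q_pr /(Fp_dvd_eq0 p_pr) s0.
have {}s0 : \sum_(i < q) (b%:~R : 'F_p) ^+ i = 0.
  by rewrite -[RHS]s0 rmorph_sum; apply: eq_bigr => i _; rewrite rmorphXn.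
set x : 'F_p := b%:~R in s0.
have xq1 : x ^+ q = 1 by apply/eqP; rewrite -subr_eq0 subrX1 s0 mulr0.
have x0 : x != 0.
  apply/eqP => x0; move/eqP: xq1.
  by rewrite x0 expr0n gtn_eqF ?prime_gt0 //= eq_sym oner_eq0.
have [d dx] := prim_order_exists (prime_gt0 q_pr) xq1.
case/primeP: (q_pr) => _ /[apply] /orP[] /eqP dE; subst d.
  have x1 : x = 1 by rewrite -(prim_expr_order dx).
  move: s0; rewrite x1; under eq_bigr do rewrite expr1n.
  rewrite sumr_const card_ord => /eqP.
  by rewrite -(dvdn_pcharf (pchar_Fp p_pr)) dvdn_prime2 // => /eqP ->.
apply: leq_trans (leq_pred p); apply: dvdn_leq.
  by case: (p) (prime_gt1 p_pr) => [|[]].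
by rewrite (prim_order_dvd dx) Fp_fermat.
Qed.

Lemma prime_order_odd_above (b : int) (N : nat) : (1 < `|b|)%N ->
  exists2 p : Primes, (N < val p)%N &
    exists2 q : nat, odd q & (b%:~R : 'F_(val p)) ^+ q = 1.
Proof.
(* The bound 2 makes the prime q odd and the geometric sum large enough to have a prime factor; the
   bound N passes on to that factor. *)
move=> b_gt1; have [q] := prime_above (maxn N 2).
rewrite gtn_max => /andP[Nq q_gt2] q_pr.
have s_gt1 := geometric_sum_gt1 b_gt1 q_gt2.
have p_pr := pdiv_prime s_gt1; set p := pdiv _ in p_pr.
have p_dvd : (p %| `|(\sum_(i < q) b ^+ i)%R|)%N by apply: pdiv_dvd.
exists (exist _ p p_pr).
  exact: leq_trans Nq (prime_factor_geometric_sum_ge p_pr q_pr p_dvd).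
exists q; first by case: (even_prime q_pr) q_gt2 => [->|].
apply/eqP; rewrite -subr_eq0 -rmorphXn /= -[1]/(1%:~R) -rmorphB subrX1.
by rewrite rmorphM /= (Fp_dvd_eq0 p_pr p_dvd) mulr0.
Qed.

(** * Pairwise coprime polynomials *)

(* Equals n^(2^i) Phi(X^2 / n), where Phi = X^(2^i) + 1 is the cyclotomic
   polynomial of order 2^(i+1). *)
Definition sqrt_cyclotomic (n : int) (i : nat) : {poly rat} :=
  'X^(2 ^ i.+1) + ((n ^+ (2 ^ i))%:~R)%:P.

(** With Y = X^(2^(i+1)) and M = 2^(m+1), where j = i + 1 + m, the first polynomial Y + c divides
    Y^M - c^M since M is even, while the second is Y^M + c^M. They differ by the nonzero constant
    2c^M. *)
Lemma sqrt_cyclotomic_coprime (n : int) (i j : nat) : n != 0 ->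
  (i < j)%N -> coprimep (sqrt_cyclotomic n i) (sqrt_cyclotomic n j).
Proof.
move=> n0 /subnKC <-; move: (j - i.+1)%N => m.
set c : rat := (n ^+ (2 ^ i))%:~R; set d := c ^+ (2 ^ m.+1).
have d0 : d *+ 2 != 0 by rewrite mulrn_eq0 /d /c expf_neq0 ?intr_eq0 ?expf_neq0.
have jE : sqrt_cyclotomic n (i.+1 + m) =
    ('X^(2 ^ i.+1)) ^+ (2 ^ m.+1) + d%:P.
  rewrite /sqrt_cyclotomic /d /c -rmorphXn /= -!exprM -!expnD.
  by rewrite addSnnS addSn.
have : sqrt_cyclotomic n i %| ('X^(2 ^ i.+1)) ^+ (2 ^ m.+1) - d%:P.
  have -> : d%:P = ((- c)%:P) ^+ (2 ^ m.+1) :> {poly rat}.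
    by rewrite -rmorphXn /= exprNn -signr_odd oddX expr0 mul1r.
  by rewrite subrXX /sqrt_cyclotomic polyCN opprK dvdp_mulIl.
case/dvdpP => r rE; apply/Bezout_eq1_coprimepP.
exists (- (d *+ 2)^-1%:P * r, (d *+ 2)^-1%:P) => /=.
rewrite -mulrA -rE jE mulNr addrC -mulrBr opprB.
by rewrite [X in _ * X]addrC addrA subrK -polyCD -mulr2n -polyCM mulVf.
Qed.

(** Induction on the size of g: a nontrivial common factor with the i-th polynomial is coprime to
    all later ones, so it can be divided out of g. *)
Lemma coprime_sqrt_cyclotomic (n : int) (g : {poly rat}) : n != 0 -> g != 0 ->
  exists J, forall j, (J <= j)%N -> coprimep g (sqrt_cyclotomic n j).
Proof.
move=> n0; have [N] := ubnP (size g); elim: N => // N IH in g * => g_lt g0.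
have [[i Ni]|all_coprime] :=
    pselect (exists i, ~~ coprimep g (sqrt_cyclotomic n i)).
  set d := gcdp g (sqrt_cyclotomic n i).
  have /dvdpP[h gE] : d %| g by apply: dvdp_gcdl.
  have [h0 d0] : h != 0 /\ d != 0.
    by apply/andP; rewrite -negb_or -mulf_eq0 -gE.
  have d_gt1 : (1 < size d)%N.
    by rewrite ltn_neqAle eq_sym Ni /= size_poly_gt0.
  have h_lt : (size h < N)%N.
    move: g_lt d_gt1; rewrite gE size_mul //.
    case: (size d) => [|[|e]] //; rewrite addnS /= ltnS => + _.
    by apply: leq_trans; rewrite addnS ltnS leq_addr.
  have [J HJ] := IH h h_lt h0.
  exists (maxn J i.+1) => j; rewrite geq_max => /andP[Jj ij].
  rewrite gE coprimepMl HJ //=.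
  apply: coprimep_dvdr (sqrt_cyclotomic_coprime n0 ij).
  exact: dvdp_gcdr.
exists 0%N => j _; apply/negPn/negP => Nj; apply: all_coprime.
by exists j.
Qed.

(** * Exceptional primes and evaluation in [scrA] *)

Lemma classA_eq_finite (f g : prodF) :
  classA f = classA g -> finite_set [set p | f p != g p]%classic.
Proof.
move/eqP; rewrite /classA -[_ == _]/(_ == _ %[mod {ideal_quot sumF}])%qT.
rewrite eqmodE => /asboolP; apply: sub_finite_set => p /=.
by apply: contra_neq => /subr0_eq.
Qed.

Lemma classA_mul1_finite (f : prodF) (y : scrA) :
  y * classA f = 1 -> finite_set [set p | f p == 0]%classic.
Proof.
rewrite -[y]reprK -(rmorph1 (\pi_scrA%qT : prodF -> scrA)) -rmorphM.
move/classA_eq_finite; apply: sub_finite_set => p /= /eqP fp0.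
change (repr y p * f p != 1); by rewrite fp0 mulr0 eq_sym oner_eq0.
Qed.

Lemma finite_Primes_bounded (S : set Primes) :
  finite_set S -> exists N, forall p, S p -> (val p <= N)%N.
Proof.
case/finite_seqP => s ->; exists (\max_(q <- s) val q) => p /= ps.
exact: (@leq_bigmax_seq _ s xpredT (fun q : Primes => val q)).
Qed.

Lemma imageAX (a : Primes -> int) (m : nat) :
  imageA a ^+ m = imageA (fun p => a p ^+ m).
Proof.
elim: m => [|m IH].
  rewrite expr0 -(rmorph1 (\pi_scrA%qT : prodF -> scrA)).
  apply: classA_eqP.
  by apply: (sub_finite_set _ (finite_set0 Primes)) => p /= /eqP[].
rewrite exprS IH /imageA /classA -rmorphM; apply: classA_eqP.
apply: (sub_finite_set _ (finite_set0 Primes)) => p /= /eqP[].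
by rewrite exprS rmorphM.
Qed.

Lemma ratA_int (z : int) : ratA z%:~R = imageA (fun=> z).
Proof.
apply: classA_eqP; apply: (sub_finite_set _ (finite_set0 Primes)) => p /=.
by rewrite ratr_int eqxx.
Qed.

Lemma horner_sqrt_cyclotomic (a : Primes -> int) (n : int) (i : nat) :
  horner_alg (imageA a) (sqrt_cyclotomic n i) =
  imageA (fun p => a p ^+ (2 ^ i.+1) + n ^+ (2 ^ i)).
Proof.
rewrite rmorphD /= rmorphXn /= horner_algX horner_algC imageAX.
(* Scaling in [scrA] is by definition multiplication by [ratA]. *)
rewrite -[_%:A]/(ratA _ * 1) mulr1 ratA_int.
rewrite /imageA /classA -rmorphD; apply: classA_eqP.
apply: (sub_finite_set _ (finite_set0 Primes)) => p /= /eqP[].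
by rewrite rmorphD.
Qed.

(** * Vanishing modulo p and transcendence *)

Lemma root_sqrt_cyclotomic (n : int) (i q : nat) (p : Primes) : odd q ->
  ((- n ^+ (2 ^ i))%:~R : 'F_(val p)) ^+ q = 1 ->
  ((n ^+ ((k_ p + 1) %/ 2)) ^+ (2 ^ i.+1) + n ^+ (2 ^ i))%:~R = 0 :> 'F_(val p).
Proof.
move=> q_odd /(exp_k_odd_order q_odd) ck.
(* The halving is exact because k_p is odd. *)
have kE : ((k_ p + 1) %/ 2 * 2 ^ i.+1 = 2 ^ i * (k_ p).+1)%N.
  by rewrite expnS mulnA divnK ?addn1 1?mulnC // dvdn2 /= k_odd.
rewrite -exprM kE exprM; set c := n ^+ _ in ck *.
rewrite exprS rmorphD rmorphM rmorphXn /=.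
move: ck; rewrite rmorphN /= exprNn -signr_odd k_odd expr1 mulN1r => /eqP.
by rewrite eqr_oppLR => /eqP ->; rewrite mulrN1 addNr.
Qed.

Theorem theorem1p9 (n : int) :
  naively_transcendental (imageA (fun p => n ^+ ((k_ p + 1) %/ 2)))
  <-> 1 < `|n|.
Proof.
split=> [tr | n_gt1].
  rewrite ltNge; apply/negP => n_le1; apply: tr.
  (* Its roots 0, 1 and -1 contain all powers of n when |n| <= 1. *)
  exists ('X^3 - 'X).
    by rewrite -size_poly_eq0 size_polyDl ?size_polyN ?size_polyXn ?size_polyX.
  rewrite rmorphB rmorphXn /= horner_algX imageAX.
  apply/eqP; rewrite subr_eq0; apply/eqP.
  congr imageA; apply: funext => p.
  have e_gt0 : (0 < (k_ p + 1) %/ 2)%N.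
    by have := k_odd p; case: (k_ p) => [|k] //; lia.
  have [->|[->|->]] : n = 0 \/ n = 1 \/ n = -1 by lia.
  - by rewrite expr0n gtn_eqF.
  - by rewrite !expr1n.
  - by rewrite -signr_odd; case: odd.
case=> g g0 gx0; have n0 : n != 0 by lia.
have [i /(_ i (leqnn i))/Bezout_eq1_coprimepP[[u v] /= uv]] :=
  coprime_sqrt_cyclotomic n0 g0.
(* Evaluating the Bezout relation kills the term in g and leaves an inverse of the value of the i-th
   polynomial. *)
move/(congr1 (horner_alg (imageA (fun p => n ^+ ((k_ p + 1) %/ 2))))): uv.
rewrite rmorphD !rmorphM rmorph1 /= gx0 mulr0 add0r horner_sqrt_cyclotomic.
move/classA_mul1_finite/finite_Primes_bounded => [N HN].
have b_gt1 : (1 < `|(- n ^+ (2 ^ i))%R|)%N.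
  rewrite abszN abszX; apply: (@leq_trans (`|n| ^ 1)%N); first by lia.
  by rewrite leq_pexp2l ?expn_gt0 //; lia.
have [p Np [q q_odd cq]] := prime_order_odd_above N b_gt1.
move: Np; rewrite ltnNge HN //=.
by rewrite (root_sqrt_cyclotomic q_odd cq).
Qed.
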